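(* Let $n\ge 2$. Consider all pairs $(A,B)$ of $n\times n$ real Hurwitz matrices such that the switched system $$\dot x(t)=u(t)Ax(t)+(1-u(t))Bx(t),\qquad x\in\mathbb{R}^n,\quad u(\cdot):[0,\infty[\to[0,1]\ \text{measurable},$$ is globally uniformly exponentially stable (GUES). Then there is no integer $m$ such that every such GUES system admits a polynomial common Lyapunov function of degree at most $m$.
   Context: A real matrix is Hurwitz if all its eigenvalues have strictly negative real part. GUES: there exist constants $M,\lambda>0$ such that every solution $x(\cdot)$ of the system, for every measurable $u(\cdot)$ and every initial condition $x(0)=x_0$, satisfies $\|x(t)\|\le Me^{-\lambda t}\|x_0\|$ for all $t>0$. Common Lyapunov function (CLF): a continuous function $V:\mathbb{R}^n\to\mathbb{R}^+$ that is positive definite ($V(0)=0$ and $V(x)>0$ for all $x\neq0$) and strictly decreasing along every nonconstant trajectory of the system (for every measurable $u(\cdot)$). *)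

(* Defs.v *)
From mathcomp Require Import all_boot all_order all_algebra.
From mathcomp Require Import all_classical all_reals all_analysis.
From mathcomp Require Import complex.
(* The notations of mpoly clash with those of MathComp-Analysis. *)
From mathcomp Require Import (canonicals, coercions) mpoly.

Set Implicit Arguments.
Unset Strict Implicit.
Unset Printing Implicit Defensive.

Import Order.TTheory GRing.Theory Num.Theory numFieldNormedType.Exports.

Local Open Scope classical_set_scope.
Local Open Scope ring_scope.

Definition hurwitz (R : realType) (n : nat) (A : 'M[R]_n) : Prop :=
  forall z : R[i], eigenvalue (map_mx (real_complex R) A) z -> complex.Re z < 0.

(* The library norm on column vectors is the sup norm. *)
Definition enorm (R : realType) (n : nat) (x : 'cV[R]_n) : R :=
  Num.sqrt (\sum_(i < n) x i 0 ^+ 2).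

Definition abs_continuous (R : realType) (V : normedModType R) (a b : R)
    (f : R -> V) : Prop :=
  forall e : R, 0 < e -> exists2 d : R, 0 < d &
    forall (k : nat) (s t : 'I_k -> R),
      (forall i, [&& a <= s i, s i < t i & t i <= b]) ->
      trivIset setT (fun i => `]s i, t i[%classic) ->
      \sum_(i < k) (t i - s i) < d ->
      \sum_(i < k) `|f (t i) - f (s i)| < e.

(* Measurability is with respect to the Borel sets.  A Lebesgue measurable u
   is a.e. equal to a Borel one, and [solution] below depends on u only up to
   null sets, so the trajectories are the same for both readings. *)
Definition switching_function (R : realType) (u : R -> R) : Prop :=
  measurable_fun (`[0, +oo[%classic : set R) u /\ forall t : R, 0 <= t -> 0 <= u t <= 1.

(* Solutions in the sense of Caratheodory; only the values of x and u on
   [0, +oo[ matter. *)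
Definition solution (R : realType) (n : nat) (A B : 'M[R]_n) (u : R -> R)
    (x : R -> 'cV[R]_n) : Prop :=
  (forall T : R, 0 < T -> abs_continuous 0 T x) /\
  {ae @lebesgue_measure R, forall t : R, 0 < t ->
     is_derive t (1 : R) x (u t *: (A *m x t) + (1 - u t) *: (B *m x t))}.

Definition GUES (R : realType) (n : nat) (A B : 'M[R]_n) : Prop :=
  exists M lambda : R, [/\ 0 < M, 0 < lambda &
    forall (u : R -> R) (x : R -> 'cV[R]_n) (x0 : 'cV[R]_n),
      switching_function u -> solution A B u x -> x 0 = x0 ->
      forall t : R, 0 < t -> enorm (x t) <= M * expR (- lambda * t) * enorm x0].

Definition common_lyapunov (R : realType) (n : nat) (A B : 'M[R]_n)
    (V : 'cV[R]_n -> R) : Prop :=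
  [/\ continuous V,
      V 0 = 0,
      (forall x, x != 0 -> 0 < V x) &
      forall (u : R -> R) (x : R -> 'cV[R]_n),
        switching_function u -> solution A B u x ->
        (exists2 t : R, 0 <= t & x t != x 0) ->
        forall s t : R, 0 <= s -> s < t -> V (x t) < V (x s)].

Definition mpoly_fun (R : realType) (n : nat) (p : mpoly.mpoly n R)
    (x : 'cV[R]_n) : R :=
  mpoly.meval (fun i => x i 0) p.

(* msize is the total degree plus one, and 0 for the zero polynomial. *)
Definition mpoly_degree_le (R : realType) (n : nat) (p : mpoly.mpoly n R)
    (m : nat) : Prop :=
  (mpoly.msize p <= m.+1)%N.

(* Main.v *)
(** For [e >= 0] consider, in the plane of the first two coordinates,
      A_e : x' = - e x,            y' = (- x - y) - e y,
      B_e : x' = (y - x) - e x,    y' = - e y,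
    all other coordinates obeying z' = - e z.  The sup norm decays along every
    trajectory of the switched system, with a rate governed by e, so the pair is
    GUES when [e > 0].  For [e = 0] the trajectories switching at the corners,
    which are reached in infinite time, go round the boundary of every square
    |x|, |y| <= a.  Polynomial common Lyapunov
    functions of degree at most m for e = 1, 1/2, 1/3, ..., restricted to the
    plane and normalised, accumulate at a nonzero polynomial which vanishes at 0
    and is nonincreasing for [e = 0], hence constant on the boundary of every
    square.  Such a polynomial is a polynomial in x alone and in y alone, hence
    zero. *)

Require Import Defs.
From mathcomp Require Import all_boot all_order all_algebra.
From mathcomp Require Import all_classical all_reals all_analysis.
From mathcomp Require Import complex lra ring.
From mathcomp Require mpoly.
From mathcomp Require Import (canonicals) mpoly.

Set Implicit Arguments.
Unset Strict Implicit.
Unset Printing Implicit Defensive.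

Import Order.TTheory GRing.Theory Num.Theory numFieldNormedType.Exports.

Local Open Scope classical_set_scope.
Local Open Scope ring_scope.

(** * Absolutely continuous functions with bounded derivative *)

(** Real induction: at the supremum of the points [t] with [P a t], the local hypothesis joins such
    a point to one beyond the supremum, unless the supremum is already [b]. *)
Lemma segment_chain (R : realType) (P : R -> R -> Prop) (a b : R) : a <= b ->
  (forall s t u, s <= t -> t <= u -> P s t -> P t u -> P s u) ->
  (forall t, a <= t <= b -> exists2 d, 0 < d &
     forall s s', a <= s <= t -> t <= s' <= b -> s' - s < d -> P s s') ->
  P a b.
Proof.
move=> ab trP locP; pose S := [set t | a <= t <= b /\ P a t].
have Sa : S a.
  split; first by rewrite lexx.
  have [|d d0] := locP a; first by rewrite lexx.
  by apply; rewrite ?subrr ?lexx.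
have Sb : ubound S b by move=> t [/andP[]].
have supS : has_sup S by split; [exists a | exists b].
have am : a <= sup S by exact: sup_upper_bound supS _ Sa.
have mb : sup S <= b by apply: ge_sup => //; exists a.
have [|d d0 dP] := locP (sup S); first by rewrite am.
have d2 : 0 < d / 2 by rewrite divr_gt0.
have [s [/andP[as_ sb] Ps] ms] := sup_adherent d2 supS.
have sm : s <= sup S by apply: (sup_upper_bound supS); split=> //; rewrite as_.
pose s' := Num.min b (sup S + d / 2).
have ms' : sup S <= s' by rewrite le_min mb lerDl ltW.
have s'b : s' <= b by rewrite ge_min lexx.
have s'd : s' <= sup S + d / 2 by rewrite ge_min lexx orbT.
have Ps' : P a s'.
  apply: (trP a s s') => //; first exact: le_trans ms'.
  by apply: dP; rewrite ?as_ ?ms' //; lra.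
have : s' <= sup S.
  by apply: (sup_upper_bound supS); split => //; rewrite s'b (le_trans am).
rewrite ge_min => /orP[bm|]; last by lra.
suff -> : b = s' by [].
by apply/eqP; rewrite eq_le s'b andbT (le_trans bm).
Qed.

Lemma negligible_open_cover (R : realType) (N : set R) (d : R) :
  (@lebesgue_measure R).-negligible N -> 0 < d ->
  exists U : set R, [/\ open U, N `<=` U & (lebesgue_measure U < d%:E)%E].
Proof.
move=> [Z [mZ Z0 NZ]] d0.
have [|U [oU ZU UZ]] := @lebesgue_regularity_outer R Z d mZ _ d0.
  by move: Z0 => /= ->; rewrite ltry.
exists U; split => //; first exact: subset_trans ZU.
have mU : measurable U by exact: measurable_realfun.open_measurable.
(* Regularity bounds the measure of [U] minus [Z]; putting the null set [Z] back changes nothing. *)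
rewrite -(setDUK ZU) setUC.
apply: le_lt_trans UZ.
rewrite measureU0 //.
exact: measurableD.
Qed.

Lemma sum_itv_le_measure (R : realType) (U : set R) (k : nat) (s t : 'I_k -> R) :
  measurable U -> (forall i, s i < t i) ->
  trivIset setT (fun i => `]s i, t i[%classic) ->
  (forall i, `]s i, t i[%classic `<=` U) ->
  ((\sum_(i < k) (t i - s i))%:E <= lebesgue_measure U)%E.
Proof.
move=> mU st tr sub.
have -> : ((\sum_(i < k) (t i - s i))%:E =
    lebesgue_measure (\bigcup_(i in [set: 'I_k]) `]s i, t i[%classic))%E.
  rewrite measure_fin_bigcup //; last exact: finite_finset.
  rewrite -sumEFin (fsbigE (index_enum 'I_k)) //=; first last.
  - by move=> i; rewrite mem_index_enum.
  - exact: index_enum_uniq.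
  apply: eq_big => [i|i _]; first by rewrite in_setT.
  by rewrite lebesgue_measure_itv /= lte_fin st.
apply: le_measure; rewrite ?inE //.
  by apply: fin_bigcup_measurable => //; exact: finite_finset.
by move=> x [i _]; exact: sub.
Qed.


(* A Cousin-type argument: cover the exceptional null set by a small open set U
   and split [a, b] into short intervals, each inside U or straddling a good
   point; absolute continuity controls the total variation over the former. *)
Lemma abs_continuous_straddle (R : realType) (f : R -> R) (a b K : R) :
  a <= b -> abs_continuous a b f ->
  {ae @lebesgue_measure R, forall t, a < t <= b -> forall e, 0 < e ->
     exists2 d, 0 < d & forall s s', a <= s <= t -> t <= s' <= b ->
       s' - s < d -> f s' - f s <= (K + e) * (s' - s)} ->
  f b - f a <= K * (b - a).
Proof.
move=> ab acf aeK.
have ba0 : 0 < b - a + 2 by rewrite ltr_wpDl ?subr_ge0.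
suff main e : 0 < e -> f b - f a <= (K + e) * (b - a) + (e + e).
  apply/ler_addgt0Pr => e e0.
  have e'0 : 0 < e / (b - a + 2) by rewrite divr_gt0.
  have := main _ e'0.
  have : e / (b - a + 2) * (b - a + 2) = e by rewrite divfK ?gt_eqF.
  by move: (e / _) => e' <-; lra.
move=> e0; have [dlt dlt0 acP] := acf _ e0.
(* The intervals inside [U] must be short enough for absolute continuity, and [|K|] times their
   total length must be at most [e]. *)
pose d1 := Num.min dlt (e / (`|K| + 1)).
have d10 : 0 < d1 by rewrite lt_min dlt0 divr_gt0 // ltr_wpDl.
pose G t := a < t <= b -> forall e, 0 < e ->
     exists2 d, 0 < d & forall s s', a <= s <= t -> t <= s' <= b ->
       s' - s < d -> f s' - f s <= (K + e) * (s' - s).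
(* The endpoint [a] is added because [G a] holds vacuously and gives no estimate. *)
have negN : (@lebesgue_measure R).-negligible ([set a] `|` ~` G).
  apply: negligibleU => //.
  exists [set a]; split => //; exact: lebesgue_measure_set1.
have [U [oU NU mUd]] := negligible_open_cover negN d10.
(* [l] lists, from left to right, the short intervals inside [U]. They too are charged at the rate
   [K + e], possibly negative; the term in [|K|] compensates for this. *)
pose P s t := exists l : seq (R * R),
  [/\ all (fun p => [&& s <= p.1, p.1 < p.2 & p.2 <= t]) l,
      pairwise (fun p q => p.2 <= q.1) l,
      (forall p, p \in l -> `]p.1, p.2[%classic `<=` U) &
      f t - f s <= (K + e) * (t - s) + \sum_(p <- l) (`|f p.2 - f p.1| + `|K| * (p.2 - p.1))].
have [l [la lp lU lf]] : P a b.
  apply: segment_chain => //.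
  - move=> s t u st tu [l [la lp lU lf]] [l' [l'a l'p l'U l'f]].
    exists (l ++ l'); split.
    + rewrite all_cat; apply/andP; split.
        by apply: sub_all la => p /and3P[-> -> /le_trans->].
      by apply: sub_all l'a => p /and3P[/(le_trans st) -> -> ->].
    + rewrite pairwise_cat lp l'p !andbT.
      apply/allrelP => p q /(allP la)/and3P[_ _ pt] /(allP l'a)/and3P[tq _ _].
      exact: le_trans tq.
    + by move=> p; rewrite mem_cat => /orP[/lU|/l'U].
    + rewrite big_cat /=; move: lf l'f.
      move: (\sum_(p <- l) _) (\sum_(p <- l') _) => S S'.
      by lra.
  - move=> t /andP[at_ tb].
    have [Ut|nUt] := pselect (U t).
      have /nbhs_ballP[d /= d0 dU] : nbhs t U by exact: open_nbhs_nbhs.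
      exists d => // s s' /andP[as_ st] /andP[ts' s'b] s'd.
      have [->|ss'] := eqVneq s s'.
        exists [::]; split => //; rewrite big_nil !subrr.
        by rewrite mulr0 addr0.
      have lss' : s < s' by rewrite lt_neqAle ss' (le_trans st).
      exists [:: (s, s')]; split => /=.
      + by rewrite !lexx lss'.
      + by [].
      + move=> q; rewrite inE => /eqP -> x /=; rewrite in_itv /= => /andP[sx xs'].
        by apply: dU; rewrite /ball /= ltr_norml; lra.
      + rewrite big_seq1 /= (le_trans (ler_norm _)) // addrCA lerDl -mulrDl.
        rewrite mulr_ge0 ?subr_ge0 ?(ltW lss') //.
        by have := ler_norm (- K); rewrite normrN; lra.
    have Gt : G t by apply: contrapT => nG; apply: nUt; apply: NU; right.
    have at' : a < t <= b.
      rewrite tb andbT lt_neqAle at_ andbT; apply/eqP => ta.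
      by apply: nUt; apply: NU; left.
    have [d d0 dP] := Gt at' _ e0.
    exists d => // s s' st ts' s'd; exists [::]; split => //.
    by rewrite big_nil addr0; exact: dP.
apply: (le_trans lf); rewrite lerD2l.
pose p i := tnth (in_tuple l) i.
have trP : trivIset setT (fun i => `](p i).1, (p i).2[%classic).
  apply/trivIsetP => i j _ _; wlog ij : i j / (i < j)%N.
    move=> H ij; case: (ltngtP i j) => ij'; first exact: H.
      by rewrite setIC H // eq_sym.
    by move: ij; rewrite (val_inj ij') eqxx.
  move=> _; rewrite -subset0 => x [] /=; rewrite !in_itv /=.
  move=> /andP[_ xpi] /andP[pjx _].
  have := pairwiseP (0, 0) lp i j (ltn_ord i) (ltn_ord j) ij.
  rewrite -!(tnth_nth _ (in_tuple l)) => /(lt_le_trans xpi).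
  by rewrite ltNge (ltW pjx).
have len : \sum_(i < size l) ((p i).2 - (p i).1) < d1.
  rewrite -lte_fin; apply: le_lt_trans mUd; apply: sum_itv_le_measure => //.
  - exact: measurable_realfun.open_measurable.
  - by move=> i; have /(allP la)/and3P[] := mem_tnth i (in_tuple l).
  - by move=> i; apply: lU; exact: mem_tnth.
rewrite big_tnth big_split /= -mulr_sumr; apply: lerD.
  apply/ltW/(acP _ (fun i => (p i).1) (fun i => (p i).2)) => //.
  - by move=> i; have /(allP la) := mem_tnth i (in_tuple l).
  - by apply: lt_le_trans len _; rewrite ge_min lexx.
apply: le_trans (_ : `|K| * (e / (`|K| + 1)) <= e).
  apply: ler_wpM2l => //; apply: ltW; apply: lt_le_trans len _.
  by rewrite ge_min lexx orbT.
by rewrite mulrCA ler_piMr ?(ltW e0) // ler_pdivrMr ?mul1r ?lerDl // ltr_wpDl.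
Qed.

(** * Decay of the sup norm *)

Lemma is_derive_approx (R : realType) (W : normedModType R) (x : R -> W)
    (t : R) (v : W) : is_derive t 1 x v ->
  forall e, 0 < e -> exists2 d, 0 < d &
    forall h, `|h| < d -> `|x (t + h) - x t - h *: v| <= e * `|h|.
Proof.
move=> [dx <-] e e0.
have /cvgrPdist_le/(_ e e0) := dx.
rewrite /dnbhs /within /= => /nbhs_ballP[d /= d0 dP].
exists d => // h hd.
have [->|h0] := eqVneq h 0.
  by rewrite addr0 subrr scale0r subr0 !normr0 mulr0.
have := dP h; rewrite /ball /= sub0r normrN => /(_ hd h0).
rewrite scaler1 [h + t]addrC => /(ler_wpM2l (normr_ge0 h)).
by rewrite -normrZ scalerBr scalerA divff // scale1r distrC [_ * e]mulrC.
Qed.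

Lemma cV_norm_coord (R : realType) (n : nat) (x : 'cV[R]_n) i :
  `|x i 0| <= `|x|.
Proof.
rewrite [leRHS]mx_normrE.
exact: (le_bigmax _ (fun ij : 'I_n * 'I_1 => `|x ij.1 ij.2|) (i, 0)).
Qed.

Lemma cV_norm_le (R : realType) (n : nat) (x : 'cV[R]_n) (K : R) :
  0 <= K -> (forall i, `|x i 0| <= K) -> `|x| <= K.
Proof.
move=> K0 xK; rewrite [leLHS]mx_normrE; apply: bigmax_le => // -[i j] _ /=.
by rewrite ord1.
Qed.

Lemma cV_norm_attained (R : realType) (n : nat) (x : 'cV[R]_n) :
  `|x| = 0 \/ exists i, `|x| = `|x i 0|.
Proof.
have [x0|/mx_norm_neq0[[i j] xij]] := eqVneq (mx_norm x) 0; first by left.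
by right; exists i; rewrite -[LHS]/(mx_norm x) xij ord1.
Qed.

Lemma ae_lebesgueS (R : realType) (P Q : R -> Prop) :
  (forall t, P t -> Q t) ->
  {ae @lebesgue_measure R, forall t, P t} ->
  {ae @lebesgue_measure R, forall t, Q t}.
Proof.
by move=> PQ; apply: negligibleS => t /=; apply: contra_not; exact: PQ.
Qed.

Lemma abs_continuous_norm (R : realType) (W : normedModType R) (x : R -> W)
    (T a b : R) : abs_continuous 0 T x -> 0 <= a -> b <= T ->
  abs_continuous a b (fun t => `|x t|).
Proof.
move=> acx a0 bT e e0; have [d d0 dP] := acx e e0.
exists d => // k s t st trst lenst.
apply: le_lt_trans (dP k s t _ trst lenst).
  by apply: ler_sum => i _; exact: ler_dist_dist.
move=> i; have /and3P[as_ -> tb] := st i.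
by rewrite (le_trans a0 as_) (le_trans tb bT).
Qed.

(* To first order, x + h v stays in the sup-norm ball of radius (1 - e h) |x|. *)
Definition inward (R : realType) (n : nat) (e : R) (x v : 'cV[R]_n) :=
  forall i, exists c y : R,
    [/\ 0 <= c <= 1, `|y| <= `|x| & v i 0 = - e * x i 0 + c * (y - x i 0)].

(** Forward, each coordinate combines [x i 0] and [y] with nonnegative weights of sum [1 - h * e];
    the bound on [h] keeps the first weight nonnegative. Backward, a coordinate attaining the norm
    suffices: its weights are [1 + h * e + h * c] and [- h * c]. *)
Lemma inward_step (R : realType) (n : nat) (e h : R) (x v : 'cV[R]_n) :
  0 <= e -> inward e x v -> 0 <= h -> h * (e + 1) <= 1 ->
  `|x + h *: v| <= (1 - h * e) * `|x| /\ (1 + h * e) * `|x| <= `|x - h *: v|.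
Proof.
move=> e0 xv h0 he.
have he0 : 0 <= h * e by rewrite mulr_ge0.
split.
  apply: cV_norm_le; first by rewrite mulr_ge0 // subr_ge0; lra.
  move=> i; have [c [y [/andP[c0 c1] yx vi]]] := xv i.
  rewrite !mxE vi.
  have -> : x i 0 + h * (- e * x i 0 + c * (y - x i 0)) =
    (1 - h * e - h * c) * x i 0 + h * c * y by ring.
  have hc0 : 0 <= h * c by rewrite mulr_ge0.
  have hc : h * c <= h by rewrite ler_piMr.
  rewrite (le_trans (ler_normD _ _)) // !normrM (ger0_norm h0) (ger0_norm c0).
  rewrite ger0_norm; last by lra.
  have -> : (1 - h * e) * `|x| = (1 - h * e - h * c) * `|x| + h * c * `|x|.
    by ring.
  apply: lerD; apply: ler_wpM2l => //; first by lra.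
  exact: cV_norm_coord.
have [->|[i xi]] := cV_norm_attained x; first by rewrite mulr0.
have [c [y [/andP[c0 c1] yx vi]]] := xv i.
apply: le_trans (cV_norm_coord _ i); rewrite !mxE vi.
have -> : x i 0 - h * (- e * x i 0 + c * (y - x i 0)) =
    (1 + h * e + h * c) * x i 0 - h * c * y by ring.
have hc0 : 0 <= h * c by rewrite mulr_ge0.
apply: le_trans (lerB_dist _ _).
rewrite !normrM (ger0_norm h0) (ger0_norm c0) -xi ger0_norm; last by lra.
have : h * c * `|y| <= h * c * `|x| by rewrite ler_wpM2l.
by lra.
Qed.

(** The sup norm need not be differentiable along [x], so estimates over intervals straddling [t]
    replace its derivative. The rate 0 gives monotonicity first; then the norm on [[s, t]] is at
    least [|x t|], which improves the rate to [- e * |x t|]. *)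
Lemma inward_norm_decay (R : realType) (n : nat) (e : R) (x : R -> 'cV[R]_n)
    (v : R -> 'cV[R]_n) : 0 <= e ->
  (forall T : R, 0 < T -> abs_continuous 0 T x) ->
  {ae @lebesgue_measure R, forall t : R, 0 < t ->
    is_derive t 1 x (v t) /\ inward e (x t) (v t)} ->
  forall s t : R, 0 <= s -> s <= t -> (1 + e * (t - s)) * `|x t| <= `|x s|.
Proof.
move=> e0 acx aex.
have straddle : {ae @lebesgue_measure R, forall t : R, 0 < t ->
    forall eta : R, 0 < eta -> exists2 d : R, 0 < d & forall s s' : R, s <= t -> t <= s' ->
     s' - s < d -> `|x s'| - `|x s| <= (- e * `|x t| + eta) * (s' - s)}.
  apply: ae_lebesgueS aex => t Ht t0 eta eta0; have [dx xv] := Ht t0.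
  have [d d0 dP] := is_derive_approx dx eta0.
  exists (Num.min d (e + 1)^-1).
    by rewrite lt_min d0 invr_gt0 ltr_wpDl.
  move=> s s' st ts'; rewrite lt_min => /andP[sd se].
  have e1 : 0 < e + 1 by rewrite ltr_wpDl.
  have small h : 0 <= h -> h <= s' - s -> `|h| < d /\ h * (e + 1) <= 1.
    move=> h0 hs; rewrite ger0_norm //; split; first by lra.
    by rewrite -ler_pdivlMr // div1r; lra.
  have [ad ae] : `|s' - t| < d /\ (s' - t) * (e + 1) <= 1 by apply: small; lra.
  have [bd be] : `|t - s| < d /\ (t - s) * (e + 1) <= 1 by apply: small; lra.
  have a0 : 0 <= s' - t by lra.
  have b0 : 0 <= t - s by lra.
  have [A _] := inward_step e0 xv a0 ae.
  have [_ B] := inward_step e0 xv b0 be.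
  have := dP _ ad; rewrite subrKC (ger0_norm a0) => A'.
  have := dP (s - t); rewrite distrC => /(_ bd).
  rewrite subrKC (ger0_norm b0) -[s - t]opprB scaleNr opprK => B'.
  have {}A : `|x s'| <= (1 - (s' - t) * e) * `|x t| + eta * (s' - t).
    rewrite -[x s'](subrK (x t + (s' - t) *: v t)) addrC.
    by rewrite (le_trans (ler_normD _ _)) // lerD // opprD addrA.
  have {}B : (1 + (t - s) * e) * `|x t| <= `|x s| + eta * (t - s).
    apply: (le_trans B); rewrite -lerBlDl.
    apply: le_trans B'.
    have -> : x s - x t + (t - s) *: v t = - (x t - (t - s) *: v t - x s).
      by rewrite !opprB addrA addrAC.
    by rewrite normrN lerB_dist.
  by lra.
have rate K s t : 0 <= s -> s < t ->
    (forall r, s <= r <= t -> - e * `|x r| <= K) ->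
    `|x t| - `|x s| <= K * (t - s).
  move=> s0 st rK; apply: (@abs_continuous_straddle _ (fun r => `|x r|)).
  - exact: ltW.
  - by apply: (abs_continuous_norm (T := t)) => //; apply: acx; lra.
  - apply: ae_lebesgueS straddle => r Hr /andP[sr rt] eta eta0.
    have [|d d0 dP] := Hr _ eta eta0; first by lra.
    exists d => // u w /andP[su ur] /andP[rw wt] uw.
    apply: le_trans (dP _ _ ur rw uw) _; apply: ler_wpM2r; first by lra.
    by rewrite lerD2r; apply: rK; rewrite (ltW sr).
have mono s t : 0 <= s -> s <= t -> `|x t| <= `|x s|.
  move=> s0; rewrite le_eqVlt => /orP[/eqP->//|st].
  rewrite -subr_le0 -(mul0r (t - s)); apply: rate => // r _.
  by rewrite mulNr oppr_le0 mulr_ge0.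
move=> s t s0; rewrite le_eqVlt => /orP[/eqP->|st].
  by rewrite subrr mulr0 addr0 mul1r.
have : `|x t| - `|x s| <= (- e * `|x t|) * (t - s).
  apply: rate => // r /andP[sr rt].
  by rewrite !mulNr lerN2 ler_wpM2l // mono // (le_trans s0).
by lra.
Qed.

(** The hypothesis is iterated over [k] equal steps of length [h]. Halving the rate lets
    [expR (y / 2) <= 1 + y], valid for [0 <= y <= 1], turn the product into an exponential. *)
Lemma expR_decay (R : realType) (f : R -> R) (e : R) : 0 <= e ->
  (forall s t, 0 <= s -> s <= t -> (1 + e * (t - s)) * f t <= f s) ->
  (forall t, 0 <= f t) ->
  forall t, 0 <= t -> f t <= expR (- (e / 2) * t) * f 0.
Proof.
move=> e0 fe f0 t t0.
(* More than [e * t] steps, so that [e * h <= 1]. *)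
pose k := (Num.truncn (e * t)).+1.
have k0 : 0 < k%:R :> R by rewrite ltr0n.
pose h := t / k%:R.
have h0 : 0 <= h by rewrite divr_ge0.
have eh1 : e * h <= 1.
  by rewrite mulrA ler_pdivrMr // mul1r ltW // truncnS_gt.
have eh0 : 0 <= e * h by rewrite mulr_ge0.
(* With [y = e * h]: [expR (- (y / 2)) >= 1 - y / 2] and [(1 - y / 2) * (1 + y) >= 1]. *)
have step : expR (e * h / 2) <= 1 + e * h.
  have := expR_ge1Dx (- (e * h / 2)); rewrite expRN.
  have := expR_gt0 (e * h / 2); move: (expR _) => E E0.
  rewrite -[X in _ <= X]div1r ler_pdivlMr // => H.
  have : E * (1 - e * h / 2) * (1 + e * h) <= 1 + e * h.
    by rewrite [E * _]mulrC ler_piMl //; lra.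
  apply: le_trans.
  rewrite -mulrA ler_peMr ?(ltW E0) //.
  by move: (e * h) eh0 eh1 => y y0 y1; nra.
have iter j : expR (e * h / 2) ^+ j * f (j%:R * h) <= f 0.
  elim: j => [|j IH]; first by rewrite expr0 mul1r mul0r.
  apply: le_trans IH; rewrite exprSr -mulrA ler_wpM2l ?exprn_ge0 ?expR_ge0 //.
  have jh : j%:R * h <= j.+1%:R * h by rewrite ler_wpM2r // ler_nat.
  have := fe _ _ (mulr_ge0 (ler0n _ j) h0) jh.
  rewrite -mulrBl -natrB // subSnn mul1r; apply: le_trans.
  by rewrite ler_wpM2r.
have := iter k; rewrite -expRM_natl.
have -> : k%:R * h = t by rewrite mulrC divfK ?gt_eqF.
have -> : k%:R * (e * h / 2) = e / 2 * t.
  by rewrite -[in RHS](divfK (lt0r_neq0 k0) t) -/h; lra.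
move=> H; rewrite mulNr expRN ler_pdivlMl ?expR_gt0 //.
Qed.

(** * Norm comparison; the Hurwitz and GUES properties of the pairs *)

Lemma norm_le_enorm (R : realType) (n : nat) (x : 'cV[R]_n) : `|x| <= enorm x.
Proof.
apply: cV_norm_le; first exact: sqrtr_ge0.
move=> i; rewrite -sqrtr_sqr ler_sqrt ?sumr_ge0 // => [|j _]; last exact: sqr_ge0.
by rewrite (bigD1 i) //= lerDl sumr_ge0 // => j _; exact: sqr_ge0.
Qed.

Lemma enorm_le_norm (R : realType) (n : nat) (x : 'cV[R]_n) :
  enorm x <= Num.sqrt n%:R * `|x|.
Proof.
rewrite -[X in _ * X]ger0_norm // -sqrtr_sqr -sqrtrM ?ler0n // ler_sqrt; last first.
  by rewrite mulr_ge0 ?sqr_ge0.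
rewrite mulr_natl -[X in _ *+ X]card_ord -sumr_const ler_sum // => i _.
by rewrite -real_normK ?num_real // ler_sqr ?nnegrE // cV_norm_coord.
Qed.

(* The vector field with i-th coordinate [- e x_i + (s x_j - x_i)] and k-th
   coordinate [- e x_k] for all other k. *)
Definition edge_mx (F : fieldType) (n : nat) (e s : F) (i j : 'I_n) : 'M[F]_n :=
  (- e)%:M + delta_mx i (0 : 'I_1) *m (s *: delta_mx 0 j - delta_mx 0 i).

Lemma edge_mxE (F : fieldType) (n : nat) (e s : F) (i j : 'I_n) (x : 'cV[F]_n) k :
  (edge_mx e s i j *m x) k 0 =
  - e * x k 0 + (k == i)%:R * (s * x j 0 - x i 0).
Proof.
rewrite mulmxDl mul_scalar_mx -mulmxA mulmxBl -scalemxAl -!rowE.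
by rewrite !mxE big_ord1 !mxE andbT.
Qed.

(** [eigenvalue] concerns row vectors. If [v 0 i = 0], the rank-one part kills [v]; otherwise
    coordinate [i] of the equation determines [z]. *)
Lemma edge_mx_left_eigen (F : fieldType) (n : nat) (e s z : F) (i j : 'I_n)
    (v : 'rV[F]_n) : i != j -> v != 0 -> v *m edge_mx e s i j = z *: v ->
  z = - e \/ z = - (e + 1).
Proof.
move=> ij v0; rewrite mulmxDr mul_mx_scalar mulmxA -colE => vz.
have [vi|vi] := eqVneq (v 0 i) 0.
  left; move: vz; have -> : col i v = 0 by apply/matrixP => a b; rewrite !mxE ord1.
  rewrite mul0mx addr0 => /eqP; rewrite -subr_eq0 -scalerBl scaler_eq0 (negbTE v0).
  by rewrite orbF subr_eq0 => /eqP.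
right; move/rowP/(_ i): vz; rewrite !mxE big_ord1 !mxE !eqxx (negbTE ij) /=.
rewrite mulr0 sub0r mulrN1 => H; apply: (mulIf vi); rewrite -H; ring.
Qed.

Lemma edge_mx_hurwitz (R : realType) (n : nat) (e s : R) (i j : 'I_n) :
  0 < e -> i != j -> hurwitz (edge_mx e s i j).
Proof.
move=> e0 ij z /eigenvalueP[v].
have -> : map_mx (real_complex R) (edge_mx e s i j) =
    edge_mx (real_complex R e) (real_complex R s) i j.
  rewrite /edge_mx map_mxD map_mxM map_mxB map_mxZ !map_delta_mx map_scalar_mx.
  by rewrite rmorphN.
move=> vz v0; have [->|->] := edge_mx_left_eigen ij v0 vz => /=; lra.
Qed.

(** The switched field is [inward]: coordinate [i] is pulled towards [s * x_j] with weight [u] and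
    [i'] towards [s' * x_j'] with weight [1 - u], and both targets lie within the sup norm. The
    factor [Num.sqrt n%:R] converts between norms. *)
Lemma edge_mx_GUES (R : realType) (n : nat) (e s s' : R) (i j i' j' : 'I_n) :
  0 < e -> `|s| <= 1 -> `|s'| <= 1 -> i != i' ->
  GUES (edge_mx e s i j) (edge_mx e s' i' j').
Proof.
move=> e0 s1 s'1 ii'; exists (Num.sqrt n%:R), (e / 2).
have n0 : (0 < n)%N by case: n i {j i' j' ii'} => [[]|].
split; [by rewrite sqrtr_gt0 ltr0n | by rewrite divr_gt0 |].
move=> u x x0 [_ u01] [acx dx] <- t t0.
apply: le_trans (enorm_le_norm _) _; rewrite -mulrA ler_wpM2l ?sqrtr_ge0 //.
apply: (@le_trans _ _ (expR (- (e / 2) * t) * `|x 0|)); last first.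
  by rewrite ler_wpM2l ?expR_ge0 // norm_le_enorm.
apply: (@expR_decay _ (fun t => `|x t|)) => //; [exact: ltW | | exact: ltW].
apply: inward_norm_decay acx _; first exact: ltW.
apply: ae_lebesgueS dx => r dx r0; split; first exact: dx.
have /andP[u0 u1] := u01 _ (ltW r0).
move=> k; rewrite mxE [X in X + _]mxE [X in _ + X]mxE !edge_mxE.
have le_scale a l : `|a| <= 1 -> `|a * x r l 0| <= `|x r|.
  move=> a1; rewrite normrM; apply: le_trans (cV_norm_coord _ l).
  by rewrite ler_piMl.
have [ki|ki] := eqVneq k i.
  exists (u r), (s * x r j 0); split; rewrite ?u0 ?u1 ?le_scale //.
  by rewrite ki (negbTE ii') /=; ring.
have [ki'|ki'] := eqVneq k i'.
  exists (1 - u r), (s' * x r j' 0); split; rewrite ?le_scale //.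
    by apply/andP; split; lra.
  by rewrite ki' /=; ring.
exists 0, 0; split; rewrite ?lexx ?ler01 ?normr0 //=; ring.
Qed.

(** * Explicit trajectories *)

Lemma lipschitz_abs_continuous (R : realType) (W : normedModType R)
    (x : R -> W) (a b L : R) : 0 <= L ->
  (forall s t, a <= s -> s < t -> `|x t - x s| <= L * (t - s)) ->
  abs_continuous a b x.
Proof.
move=> L0 xL e e0; have L1 : 0 < L + 1 by rewrite ltr_wpDl.
exists (e / (L + 1)); first by rewrite divr_gt0.
move=> k s t st _; rewrite ltr_pdivlMr // => len.
apply: (@le_lt_trans _ _ (\sum_(i < k) L * (t i - s i))).
  by apply: ler_sum => i _; have /and3P[sa sti _] := st i; exact: xL.
rewrite -mulr_sumr mulrC; apply: le_lt_trans len.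
rewrite ler_wpM2l ?lerDl // sumr_ge0 // => i _.
by have /and3P[_ /ltW sti _] := st i; rewrite subr_ge0.
Qed.

Lemma expRN_lipschitz (R : realType) (a s t : R) : 0 <= a -> 0 <= s -> s <= t ->
  `|expR (- a * t) - expR (- a * s)| <= a * (t - s).
Proof.
move=> a0 s0 st; have ast : 0 <= a * (t - s) by rewrite mulr_ge0 ?subr_ge0.
have -> : - a * t = - a * s + - (a * (t - s)) by ring.
rewrite expRD -[X in _ - X]mulr1 -mulrBr normrM ger0_norm ?expR_ge0 //.
have e1 : expR (- a * s) <= 1 by rewrite -expR0 ler_expR mulNr oppr_le0 mulr_ge0.
have e2 : expR (- (a * (t - s))) <= 1 by rewrite -expR0 ler_expR oppr_le0.
have e3 := expR_ge1Dx (- (a * (t - s))).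
rewrite ler0_norm ?subr_le0 //.
apply: le_trans (_ : 1 * - (expR (- (a * (t - s))) - 1) <= _).
  by rewrite ler_wpM2r // oppr_ge0 subr_le0.
by rewrite mul1r; lra.
Qed.

Lemma is_derive_scalel (R : realType) (W : normedModType R) (g : R -> R)
    (t dg : R) (w : W) :
  is_derive t 1 g dg -> is_derive t 1 (fun r => g r *: w) (dg *: w).
Proof.
move=> [ddg <-].
have cv : (fun h => h^-1 *: (((fun r => g r *: w) \o shift t) (h *: 1) - g t *: w))
    @ 0^' --> 'D_1 g t *: w.
  have -> : (fun h => h^-1 *: (((fun r => g r *: w) \o shift t) (h *: 1) - g t *: w))
      = (fun h => (h^-1 *: ((g \o shift t) (h *: 1) - g t)) *: w).
    by apply/funext => h /=; rewrite -scalerBl scalerA.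
  by apply: cvgZ; [exact: ddg | exact: cvg_cst].
by split; [apply/cvgP: cv | apply/cvg_lim: cv].
Qed.

Lemma eigen_solution (R : realType) (n : nat) (A B C : 'M[R]_n) (c al be : R)
    (v w : 'cV[R]_n) : c *: A + (1 - c) *: B = C -> 0 <= al -> 0 <= be ->
  C *m v = - al *: v -> C *m w = - be *: w ->
  solution A B (fun=> c) (fun t => expR (- al * t) *: v + expR (- be * t) *: w).
Proof.
move=> CE al0 be0 Cv Cw; split.
  move=> T T0.
  apply: (@lipschitz_abs_continuous _ _ _ _ _ (al * `|v| + be * `|w|)).
    by rewrite addr_ge0 // mulr_ge0.
  move=> s t s0 st.
  rewrite opprD addrACA -!scalerBl (le_trans (ler_normD _ _)) // !normrZ mulrDl.
  apply: lerD; rewrite mulrAC ler_wpM2r // expRN_lipschitz // ltW //.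
apply: aeW => t _.
have dexp (a : R) : is_derive t 1 (fun r => expR (- a * r)) (- a * expR (- a * t)).
  rewrite mulrC; apply: (@is_derive1_comp _ expR).
  have := @is_deriveZ _ _ _ _ (- a) _ _ _ (is_derive_id t (1 : R)).
  by rewrite scaler1.
apply: is_derive_eq.
  by apply: is_deriveD; apply: is_derive_scalel; exact: dexp.
rewrite !scalemxAl -mulmxDl CE mulmxDr -!scalemxAr Cv Cw !scalerA.
by rewrite ![expR _ * _]mulrC.
Qed.

Lemma common_lyapunov_le (R : realType) (n : nat) (A B : 'M[R]_n) V u x t :
  common_lyapunov A B V -> switching_function u -> solution A B u x ->
  0 <= t -> V (x t) <= V (x 0).
Proof.
move=> [_ _ _ dec] su sx t0.
have [->//|xt] := eqVneq (x t) (x 0).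
apply/ltW/(dec u x su sx) => //; first by exists t.
by rewrite lt_neqAle t0 andbT; apply: contra_neq xt => <-.
Qed.

(** Up to the factor [expR (- (e * t))], coordinate [j] stays at [a] while coordinate [i] runs from
    [b] towards [s * a]. For [s = 1] or [s = -1] this is motion along a line containing a side of a
    square, towards a corner. *)
Lemma edge_mx_solution (R : realType) (n : nat) (A B : 'M[R]_n) (c e s : R)
    (i j : 'I_n) (a b : R) : i != j -> 0 <= e ->
  c *: A + (1 - c) *: B = edge_mx e s i j ->
  exists x : R -> 'cV[R]_n,
    [/\ solution A B (fun=> c) x, x 0 = a *: delta_mx j 0 + b *: delta_mx i 0 &
     forall t, x t = (expR (- (e * t)) * a) *: delta_mx j 0 +
       (expR (- (e * t)) * (s * a + (b - s * a) * expR (- t))) *: delta_mx i 0].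
Proof.
move=> ij e0 CE.
(* The initial point is split into eigenvectors for [- e] and [- (e + 1)]. *)
pose v : 'cV[R]_n := a *: (delta_mx j 0 + s *: delta_mx i 0).
pose w : 'cV[R]_n := (b - s * a) *: delta_mx i 0.
have Cv : edge_mx e s i j *m v = - e *: v.
  apply/colP => k; rewrite edge_mxE !mxE !eqxx (negbTE ij) (eq_sym j) (negbTE ij) /=.
  by ring.
have Cw : edge_mx e s i j *m w = - (e + 1) *: w.
  apply/colP => k; rewrite edge_mxE !mxE !eqxx (eq_sym j) (negbTE ij) andbT /=.
  by ring.
have e10 : 0 <= e + 1 by rewrite addr_ge0.
have xE t : expR (- e * t) *: v + expR (- (e + 1) * t) *: w =
    (expR (- (e * t)) * a) *: delta_mx j 0 +
    (expR (- (e * t)) * (s * a + (b - s * a) * expR (- t))) *: delta_mx i 0.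
  rewrite mulNr mulNr [(e + 1) * t]mulrDl mul1r opprD expRD.
  by apply/colP => k; rewrite !mxE; ring.
exists (fun t => expR (- e * t) *: v + expR (- (e + 1) * t) *: w).
split => //; first exact: eigen_solution CE e0 e10 Cv Cw.
by rewrite xE mulr0 oppr0 expR0; apply/colP => k; rewrite !mxE; ring.
Qed.

(** * Polynomials in two variables *)

Lemma poly_eq0_near0 (R : realType) (q : {poly R}) (d : R) : 0 < d ->
  (forall y, 0 < y -> y <= d -> q.[y] = 0) -> q = 0.
Proof.
move=> d0 qy; apply/eqP; apply: contraT => q0.
pose rs := [seq d / k.+1%:R | k <- iota 0 (size q)].
have k0 k : 0 < k.+1%:R :> R by rewrite ltr0n.
suff : (size rs < size q)%N by rewrite size_map size_iota ltnn.
apply: max_poly_roots => //.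
  apply/allP => _ /mapP[k _ ->]; apply/rootP; apply: qy.
    by rewrite divr_gt0.
  by rewrite ler_pdivrMr // ler_peMr ?(ltW d0) // ler1n.
rewrite map_inj_uniq ?iota_uniq // => k l /(mulfI (lt0r_neq0 d0)) /invr_inj /eqP.
by rewrite eqr_nat => /eqP[].
Qed.

(** Coefficients are kept in a matrix so that compactness of a finite-dimensional unit sphere
    applies to them. *)
Definition poly2 (R : comNzRingType) (N : nat) (C : 'M[R]_N) (a b : R) : R :=
  \sum_(i < N) \sum_(j < N) C i j * (a ^+ i * b ^+ j).

Lemma poly2_tr (R : comNzRingType) (N : nat) (C : 'M[R]_N) (a b : R) :
  poly2 C^T a b = poly2 C b a.
Proof.
rewrite /poly2 exchange_big; apply: eq_bigr => i _; apply: eq_bigr => j _.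
by rewrite mxE [a ^+ _ * _]mulrC.
Qed.

Lemma poly2_horner (R : comNzRingType) (m : nat) (C : 'M[R]_m.+1) (a b : R) :
  poly2 C a b =
  (\poly_(j < m.+1) (\poly_(i < m.+1) C (inord i) (inord j)).[a]).[b].
Proof.
rewrite horner_poly /poly2 exchange_big; apply: eq_bigr => j _.
rewrite horner_poly mulr_suml; apply: eq_bigr => i _.
by rewrite !inord_val mulrA.
Qed.

(** For fixed [a > 0] the polynomial in [y] is constant on an interval, so its coefficient of
    positive degree [j] vanishes. That coefficient is a polynomial in [a] with infinitely many
    zeros. *)
Lemma poly2_const_coef (R : realType) (m : nat) (C : 'M[R]_m.+1) :
  (forall a y, 0 < y -> y <= a -> poly2 C a y = poly2 C a a) ->
  forall i (j : 'I_m.+1), j != 0 -> C i j = 0.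
Proof.
move=> Ca i j j0.
pose q a := \poly_(j < m.+1) (\poly_(i < m.+1) C (inord i) (inord j)).[a].
suff -> : C i j = (\poly_(i < m.+1) C (inord i) (inord j))`_i.
  suff -> : \poly_(i < m.+1) C (inord i) (inord j) = 0 by rewrite coef0.
  apply: (@poly_eq0_near0 _ _ 1) => // a a0 _.
  have qa : q a - (poly2 C a a)%:P = 0.
    apply: (@poly_eq0_near0 _ _ a) => // y y0 ya.
    by rewrite hornerD hornerN hornerC -poly2_horner Ca ?subrr.
  move/polyP/(_ j): qa; rewrite coefB coefC coef_poly ltn_ord coef0.
  by rewrite -[(j : nat) == 0%N]/(j == 0) (negbTE j0) subr0.
by rewrite coef_poly ltn_ord !inord_val.
Qed.

(** Needed because a corner is only approached: it corresponds to [tau = 0], that is, to infinite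
    time. *)
Lemma poly2_le_limit (R : realType) (m : nat) (C : 'M[R]_m.+1) (a b c K : R) :
  (forall tau, 0 < tau -> tau <= 1 -> poly2 C a (b + c * tau) <= K) ->
  poly2 C a b <= K.
Proof.
move=> H.
pose q := \poly_(j < m.+1) (\poly_(i < m.+1) C (inord i) (inord j)).[a]
   \Po (b%:P + c *: 'X).
have qE tau : q.[tau] = poly2 C a (b + c * tau).
  by rewrite horner_comp poly2_horner !hornerE.
have -> : poly2 C a b = q.[0] by rewrite qE mulr0 addr0.
have cq : q.[x] @[x --> 0^'+] --> q.[0].
  apply: cvg_at_right_filter; exact: continuous_horner.
rewrite -(cvg_lim _ cq) //; apply: limr_le; first by apply/cvgP: cq.
near=> tau; rewrite qE; apply: H; near: tau.
  exact: nbhs_right_gt.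
exact: nbhs_right_le.
Unshelve. all: by end_near.
Qed.

Lemma poly2_at0 (R : comNzRingType) (m : nat) (C : 'M[R]_m.+1) :
  poly2 C 0 0 = C 0 0.
Proof.
rewrite /poly2 (bigD1 0) //= [X in _ + X]big1 => [|i i0]; last first.
  rewrite big1 // => j _.
  by rewrite expr0n -[(i : nat) == 0%N]/(i == 0) (negbTE i0) mul0r mulr0.
rewrite (bigD1 0) //= big1 => [|j j0]; first by rewrite !expr0 !mulr1 !addr0.
by rewrite [_ ^+ j]expr0n -[(j : nat) == 0%N]/(j == 0) (negbTE j0) !mulr0.
Qed.

(* The extreme values of [f a -] and [f - b] on the sides of a square are taken
   at its corners, and the inequalities go round the four corners. *)
Lemma poly2_square_eq0 (R : realType) (m : nat) (C : 'M[R]_m.+1) :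
  poly2 C 0 0 = 0 ->
  (forall a b tau, 0 < tau -> tau <= 1 ->
     poly2 C a (- a + (b + a) * tau) <= poly2 C a b) ->
  (forall a b tau, 0 < tau -> tau <= 1 ->
     poly2 C (b + (a - b) * tau) b <= poly2 C a b) ->
  C = 0.
Proof.
move=> C0 CA CB.
have minA a b : poly2 C a (- a) <= poly2 C a b.
  by apply: (@poly2_le_limit _ _ _ _ _ (b + a)) => tau; exact: CA.
have minB a b : poly2 C b b <= poly2 C a b.
  rewrite -poly2_tr.
  apply: (@poly2_le_limit _ _ _ _ _ (a - b)) => tau t0 t1.
  by rewrite poly2_tr; exact: CB.
(* With [f = poly2 C], the cycle is [f a a <= f (-a) a <= f (-a) (-a) <= f a (-a) <= f a a]. *)
have corner1 a : poly2 C a (- a) = poly2 C a a.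
  apply/eqP; rewrite eq_le minA /=.
  apply: le_trans (minB (- a) a) _.
  have := minA (- a) (- a); rewrite opprK => /le_trans; apply.
  exact: minB.
have corner2 b : poly2 C (- b) b = poly2 C b b.
  apply/eqP; rewrite eq_le minB andbT.
  have := minA (- b) (- b); rewrite opprK => /le_trans; apply.
  by rewrite -(corner1 b); exact: minB.
have sideA a y : 0 < y -> y <= a -> poly2 C a y = poly2 C a a.
  move=> y0 ya; have aa : 0 < a + a by lra.
  (* This [tau] places [(a, y)] on the trajectory from [(a, a)] to [(a, -a)], whose end values
     agree. *)
  have t0 : 0 < (y + a) / (a + a) by rewrite divr_gt0 //; lra.
  have t1 : (y + a) / (a + a) <= 1 by rewrite ler_pdivrMr //; lra.
  apply/eqP; rewrite eq_le -{2}corner1 minA andbT.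
  have := CA a a _ t0 t1; rewrite mulrC divfK; last by lra.
  by rewrite addrC addrK.
have sideB a x : 0 < x -> x <= a -> poly2 C x a = poly2 C a a.
  move=> x0 xa; apply/eqP; rewrite eq_le minB andbT -corner2.
  (* At [x = a] the parameter on the trajectory from [(-a, a)] would be 0, which [CB] excludes. *)
  have [->|xa'] := eqVneq x a; first by rewrite corner2.
  have aa : 0 < a + a by lra.
  have t0 : 0 < (a - x) / (a + a) by rewrite divr_gt0 // subr_gt0 lt_neqAle xa'.
  have t1 : (a - x) / (a + a) <= 1 by rewrite ler_pdivrMr //; lra.
  have := CB (- a) a _ t0 t1; rewrite -opprD mulNr mulrC divfK; last by lra.
  by rewrite opprB addrC subrK.
have Cj := poly2_const_coef sideA.
have Ci : forall i j : 'I_m.+1, i != 0 -> C i j = 0.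
  move=> i j i0; have -> : C i j = C^T j i by rewrite mxE.
  apply: poly2_const_coef => //.
  by move=> a y y0 ya; rewrite !poly2_tr sideB.
apply/matrixP => i j; rewrite mxE.
have [->|i0] := eqVneq i 0; last exact: Ci.
have [->|j0] := eqVneq j 0; last exact: Cj.
by rewrite -poly2_at0.
Qed.


(** A monomial of degree [d] is scaled by [expR (- d * y) >= 1 - d * y]. The bound is uniform in
    [C], so the contraction [expR (- (e * t))] costs only a multiple of [e * t]. *)
Lemma poly2_scale_le (R : realType) (N : nat) (C : 'M[R]_N) (a b y : R) :
  (forall i j, `|C i j| <= 1) -> 0 <= y ->
  poly2 C a b - poly2 C (expR (- y) * a) (expR (- y) * b) <=
  (\sum_(i < N) \sum_(j < N) (i + j)%:R * `|a ^+ i * b ^+ j|) * y.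
Proof.
move=> C1 y0; rewrite /poly2 -sumrB mulr_suml; apply: ler_sum => i _.
rewrite -sumrB mulr_suml; apply: ler_sum => j _.
rewrite !exprMn mulrACA -exprD -expRM_natl.
rewrite [C i j * (expR _ * _)]mulrCA -[X in X - _]mul1r -mulrBl.
have e0 := expR_ge1Dx ((i + j)%:R * - y).
have e1 : expR ((i + j)%:R * - y) <= 1.
  by rewrite -expR0 ler_expR mulrN oppr_le0 mulr_ge0.
apply: le_trans (ler_norm _) _; rewrite normrM ger0_norm ?subr_ge0 // mulrAC.
apply: ler_pM => //; rewrite ?subr_ge0 //; first by lra.
by rewrite normrM ler_piMl.
Qed.

(** * Restriction of Lyapunov polynomials to the plane, and compactness *)

Lemma mpoly_fun_plane (R : realType) (n m : nat) (p : mpoly.mpoly n R)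
    (i0 i1 : 'I_n) : i0 != i1 -> mpoly_degree_le p m ->
  exists C : 'M[R]_m.+1, forall a b,
    mpoly_fun p (a *: delta_mx i0 0 + b *: delta_mx i1 0) = poly2 C a b.
Proof.
move=> i01 pm.
pose x (a b : R) : 'cV[R]_n := a *: delta_mx i0 0 + b *: delta_mx i1 0.
have xE a b k : x a b k 0 = a * (k == i0)%:R + b * (k == i1)%:R.
  by rewrite !mxE !andbT.
have mono mm : mm \in mpoly.msupp p -> exists C : 'M[R]_m.+1, forall a b,
    mpoly.mcoeff mm p * \prod_k x a b k 0 ^+ mpoly.fun_of_multinom mm k =
    poly2 C a b.
  move=> mmp.
  have mN k : (mpoly.fun_of_multinom mm k < m.+1)%N.
    apply: leq_trans pm; apply: leq_ltn_trans (mpoly.msize_mdeg_lt mmp).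
    by rewrite mpoly.mdegE (bigD1 k) //= leq_addr.
  (* As [0 ^+ 0 = 1], the product is 1 when the monomial involves only the two chosen coordinates,
     and 0 otherwise. *)
  pose c := mpoly.mcoeff mm p * \prod_(k | (k != i0) && (k != i1))
    0 ^+ mpoly.fun_of_multinom mm k.
  exists (c *: delta_mx (Ordinal (mN i0)) (Ordinal (mN i1))) => a b.
  rewrite /poly2 (bigD1 (Ordinal (mN i0))) //= [X in _ = _ + X]big1 => [|i ni]; last first.
    by rewrite big1 // => j _; rewrite !mxE (negbTE ni) mulr0 mul0r.
  rewrite (bigD1 (Ordinal (mN i1))) //= [X in _ = _ + X + _]big1 => [|j nj]; last first.
    by rewrite !mxE (negbTE nj) andbF mulr0 mul0r.
  rewrite !addr0 !mxE !eqxx mulr1.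
  rewrite (bigD1 i0) //= (bigD1 i1) 1?eq_sym //= !xE !eqxx.
  rewrite (negbTE i01) eq_sym (negbTE i01) !mulr0 addr0 add0r !mulr1.
  rewrite (eq_bigr (fun k => 0 ^+ mpoly.fun_of_multinom mm k)); last first.
    by move=> k /andP[k0 k1]; rewrite xE (negbTE k0) (negbTE k1) !mulr0 addr0.
  by rewrite /c; ring.
have sumP (s : seq (mpoly.multinom n)) : {subset s <= mpoly.msupp p} ->
    exists C : 'M[R]_m.+1, forall a b,
    \sum_(mm <- s) mpoly.mcoeff mm p * \prod_k x a b k 0 ^+ mpoly.fun_of_multinom mm k =
    poly2 C a b.
  elim: s => [_|mm s IH sp].
    exists 0 => a b; rewrite big_nil /poly2 big1 // => i _.
    by rewrite big1 // => j _; rewrite mxE mul0r.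
  have [|C HC] := IH; first by move=> l ls; apply: sp; rewrite inE ls orbT.
  have [|D HD] := mono mm; first by apply: sp; rewrite mem_head.
  exists (D + C) => a b; rewrite big_cons HC HD /poly2 -big_split /=.
  apply: eq_bigr => i _; rewrite -big_split; apply: eq_bigr => j _ /=.
  by rewrite mxE mulrDl.
have [//|C HC] := sumP (mpoly.msupp p).
by exists C => a b; rewrite -HC /mpoly_fun mpoly.mevalE.
Qed.

(** [c0] is a cluster point of the sequence, chosen once for all [L]. If [L c0 > 0], then [L]
    exceeds [L c0 / 2] near [c0], whereas eventually [L (c k) <= L c0 / 2]. *)
Lemma unit_sphere_limit (R : realType) (n : nat) (c : nat -> 'rV[R]_n) :
  (forall k, `|c k| = 1) ->
  exists2 c0 : 'rV[R]_n, `|c0| = 1 &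
    forall (L : 'rV[R]_n -> R) (K : R), continuous L ->
      (forall k, L (c k) <= K * k.+1%:R^-1) -> L c0 <= 0.
Proof.
move=> c1; pose S : set 'rV[R]_n := [set x | `|x| = 1].
have cS : compact S.
  apply: bounded_closed_compact.
    by exists 1; split; rewrite ?num_real // => y y1 x /= ->; exact: ltW.
  rewrite (_ : S = (fun x : 'rV[R]_n => `|x|) @^-1` [set y | y = 1]) //.
  by apply: preimage_closed => [x _|]; [exact: norm_continuous|exact: closed_eq].
have FS : (c @ \oo) S by exists 0%N => // k _; exact: c1.
have [c0 [c01 clc]] := cS _ (fmap_proper_filter c _) FS.
exists c0 => // L K cL LK; rewrite leNgt; apply/negP => L0.
have L2 : 0 < L c0 / 2 by rewrite divr_gt0.
have near_c : \forall x \near c0, L c0 / 2 < L x.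
  by apply: (cvgr_gt _ (cL c0)); lra.
have far_c : (c @ \oo) [set x | L x <= L c0 / 2].
  pose N := Num.truncn (`|K| / (L c0 / 2)).
  exists N => // k /= Nk; apply: le_trans (LK k) _.
  rewrite ler_pdivrMr ?ltr0n //; apply: le_trans (ler_norm K) _.
  rewrite mulrC -ler_pdivrMr //; apply: ltW.
  by apply: lt_le_trans (truncnS_gt _) _; rewrite ler_nat.
have [x [/= x1 x2]] := clc _ _ far_c near_c.
by move: (lt_le_trans x2 x1); rewrite ltxx.
Qed.

Lemma poly2_continuous_coef (R : realType) (N : nat) (a b : R) :
  continuous (fun c : 'rV[R]_(N * N) => poly2 (vec_mx c) a b).
Proof.
apply: continuous_big => [|i _]; first exact: add_continuous.
apply: continuous_big => [|j _]; first exact: add_continuous.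
have -> : (fun c : 'rV[R]_(N * N) => vec_mx c i j * (a ^+ i * b ^+ j)) =
    fun c => c 0 (mxvec_index i j) * (a ^+ i * b ^+ j).
  by apply/funext => c; rewrite mxE.
move=> c; exact: cvgM (@coord_continuous _ _ _ _ _ c) (cvg_cst _).
Qed.

(** The two inequalities come from the constant controls 1 and 0. Positivity of [p] at the point
    [(1, 0)] of the plane makes [C] nonzero, so it can be normalised. *)
Lemma common_lyapunov_poly2 (R : realType) (n m : nat) (p : mpoly.mpoly n R)
    (i0 i1 : 'I_n) (e : R) : i0 != i1 -> 0 <= e -> mpoly_degree_le p m ->
  common_lyapunov (edge_mx e (-1) i1 i0) (edge_mx e 1 i0 i1) (mpoly_fun p) ->
  exists C : 'M[R]_m.+1, [/\ `|mxvec C| = 1, poly2 C 0 0 = 0 &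
    forall a b t, 0 <= t -> let r := expR (- (e * t)) in
      poly2 C (r * a) (r * (- a + (b + a) * expR (- t))) <= poly2 C a b /\
      poly2 C (r * (b + (a - b) * expR (- t))) (r * b) <= poly2 C a b].
Proof.
move=> i01 e0 pm clf.
have [C CE] := mpoly_fun_plane i01 pm.
have [_ p0 p_gt0 _] := clf.
have C00 : poly2 C 0 0 = 0 by rewrite -CE !scale0r addr0.
have C10 : 0 < poly2 C 1 0.
  rewrite -CE scale0r addr0 scale1r p_gt0 //.
  apply/eqP => /colP/(_ i0); rewrite !mxE !eqxx => /eqP.
  by rewrite oner_eq0.
have Cpos : 0 < `|mxvec C|.
  rewrite normr_gt0; apply: contraTneq C10 => /(congr1 vec_mx); rewrite mxvecK linear0 => ->.
  rewrite /poly2 big1 ?ltxx // => i _; rewrite big1 // => j _.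
  by rewrite !mxE mul0r.
have scE x y : poly2 (`|mxvec C|^-1 *: C) x y = `|mxvec C|^-1 * poly2 C x y.
  rewrite /poly2 mulr_sumr; apply: eq_bigr => i _.
  by rewrite mulr_sumr; apply: eq_bigr => j _; rewrite mxE -mulrA.
have sw c : 0 <= c <= 1 -> switching_function (fun=> c : R).
  by move=> c01; split=> [|t _]; [exact: measurable_cst | exact: c01].
exists (`|mxvec C|^-1 *: C); split.
- rewrite linearZ /= normrZ normfV normr_id mulVf // gt_eqF //.
- by rewrite scE C00 mulr0.
move=> a b t t0 r; rewrite !scE !ler_pM2l ?invr_gt0 //; split.
  have [||x [sx x0 xt]] := @edge_mx_solution R n (edge_mx e (-1) i1 i0)
    (edge_mx e 1 i0 i1) 1 e (-1) i1 i0 a b _ e0.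
  - by rewrite eq_sym.
  - by rewrite scale1r subrr scale0r addr0.
  have := common_lyapunov_le clf (sw _ _) sx t0; rewrite x0 xt !CE.
  by rewrite mulN1r opprK; apply; rewrite lexx ler01.
(* Under [u = 0] the first coordinate moves and the second is the reference, hence the swapped
   [b a]. *)
have [//||x [sx x0 xt]] := @edge_mx_solution R n (edge_mx e (-1) i1 i0)
    (edge_mx e 1 i0 i1) 0 e 1 i0 i1 b a _ e0.
  by rewrite scale0r subr0 scale1r add0r.
have := common_lyapunov_le clf (sw _ _) sx t0; rewrite x0 xt ![_ + _ *: delta_mx i0 0]addrC !CE.
by rewrite mul1r; apply; rewrite lexx ler01.
Qed.

(** * The limit as [e] tends to 0 *)

Theorem mainTheorem3 (R : realType) (n : nat) (n_ge2 : (2 <= n)%N) :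
  ~ exists m : nat, forall A B : 'M[R]_n,
      hurwitz A -> hurwitz B -> GUES A B ->
      exists p : mpoly.mpoly n R,
        mpoly_degree_le p m /\ common_lyapunov A B (mpoly_fun p).
Proof.
move=> [m Hm].
pose i0 : 'I_n := Ordinal (ltnW n_ge2); pose i1 : 'I_n := Ordinal n_ge2.
have i01 : i0 != i1 by [].
have i10 : i1 != i0 by [].
pose e k : R := k.+1%:R^-1.
have e0 k : 0 < e k by rewrite invr_gt0 ltr0n.
have /choice[C HC] k : exists C : 'M[R]_m.+1,
  [/\ `|mxvec C| = 1, poly2 C 0 0 = 0 &
    forall a b t, 0 <= t -> let r := expR (- (e k * t)) in
      poly2 C (r * a) (r * (- a + (b + a) * expR (- t))) <= poly2 C a b /\
      poly2 C (r * (b + (a - b) * expR (- t))) (r * b) <= poly2 C a b].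
  have [|||p [pm clf]] := Hm (edge_mx (e k) (-1) i1 i0) (edge_mx (e k) 1 i0 i1).
  - exact: edge_mx_hurwitz.
  - exact: edge_mx_hurwitz.
  - by apply: edge_mx_GUES; rewrite ?normrN ?normr1.
  by apply: common_lyapunov_poly2 pm clf => //; exact: ltW.
have [|c c1 limc] := @unit_sphere_limit _ _ (fun k => mxvec (C k)).
  by move=> k; have [] := HC k.
have C1 k i j : `|C k i j| <= 1.
  have [<- _ _] := HC k; rewrite -mxvecE [leRHS]mx_normrE.
  exact: (le_bigmax _ (fun ij : 'I_1 * 'I__ => `|mxvec (C k) ij.1 ij.2|) (0, _)).
(* For fixed [t], undoing the contraction in the hypothesis costs at most [K * e k], which vanishes
   in the limit. *)
have lim_le a b x y t : 0 <= t ->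
    (forall k, poly2 (C k) (expR (- (e k * t)) * x) (expR (- (e k * t)) * y)
       <= poly2 (C k) a b) ->
    poly2 (vec_mx c) x y <= poly2 (vec_mx c) a b.
  move=> t0 H; rewrite -subr_le0.
  pose K := \sum_(i < m.+1) \sum_(j < m.+1) (i + j)%:R * `|x ^+ i * y ^+ j| * t.
  apply: (limc (fun c => poly2 (vec_mx c) x y - poly2 (vec_mx c) a b) K).
    move=> d; exact: cvgB (@poly2_continuous_coef R m.+1 x y d)
      (@poly2_continuous_coef R m.+1 a b d).
  move=> k; rewrite mxvecK.
  have := poly2_scale_le x y (C1 k) (mulr_ge0 (ltW (e0 k)) t0).
  have -> : K * k.+1%:R^-1 =
    (\sum_(i < m.+1) \sum_(j < m.+1) (i + j)%:R * `|x ^+ i * y ^+ j|) * (e k * t).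
    rewrite mulrCA mulrC; congr (_ * _); rewrite /K mulr_suml.
    by apply: eq_bigr => i _; rewrite mulr_suml.
  by have := H k; lra.
have tauE tau : 0 < tau -> tau <= 1 -> exists2 t : R, 0 <= t & expR (- t) = tau.
  move=> tau0 tau1; exists (- ln tau); first by rewrite oppr_ge0 ln_le0.
  by rewrite opprK lnK.
have c0 : vec_mx c = 0 :> 'M[R]_m.+1.
  apply: poly2_square_eq0.
  (* [limc] only yields upper bounds, so the equality at 0 uses the functional and its opposite. *)
  - apply: le_anti; apply/andP; split.
      apply: (limc (fun c => poly2 (vec_mx c) 0 0) 0).
        exact: poly2_continuous_coef.
      by move=> k; rewrite mxvecK mul0r; have [_ -> _] := HC k.
    rewrite -oppr_le0; apply: (limc (fun c => - poly2 (vec_mx c) 0 0) 0).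
      by move=> d; exact: cvgN (@poly2_continuous_coef R m.+1 0 0 d).
    by move=> k; rewrite mxvecK mul0r; have [_ -> _] := HC k; rewrite oppr0.
  - move=> a b tau /tauE H /H[t t0 <-]; apply: (lim_le _ _ _ _ t) => // k.
    by have [_ _ /(_ a b t t0)[]] := HC k.
  - move=> a b tau /tauE H /H[t t0 <-]; apply: (lim_le _ _ _ _ t) => // k.
    by have [_ _ /(_ a b t t0)[]] := HC k.
move: c1; rewrite -(vec_mxK c) c0 linear0 normr0 => /eqP.
by rewrite eq_sym oner_eq0.
Qed.
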